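(* Let $G=(V,E)\sim G(n,p)$ be an Erdős–Rényi random graph on the vertex set $V$ with $|V|=n$. For a subset $A\subseteq V$, let $\mathrm{Bis}(A)$ denote the induced bipartite subgraph for the bipartition $(A,V\setminus A)$, i.e. the graph with vertex set $V$ whose edges are exactly the edges of $G$ having one endpoint in $A$ and the other in $V\setminus A$. Then: (1) If $p<1/2$ is fixed, then with high probability there exists a subset $A\subseteq V$ with $|A|=\lfloor n/2\rfloor$ such that $\mathrm{Bis}(A)$ is not connected. (2) If $p>1/2$ is fixed, then with high probability, for every subset $A\subset V$, the graph $\mathrm{Bis}(A)$ consists of a single connected component together with isolated vertices. (3) If $p=1/2+\epsilon$ with $\epsilon>0$ fixed, then with high probability, for every subset $A\subset V$ with $\bigl||A|-n/2\bigr|<\epsilon(1/2-\epsilon)n$, the graph $\mathrm{Bis}(A)$ is connected and spans $V$.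
   Context: $G(n,p)$ denotes the Erdős–Rényi model: a random simple graph on $n$ labeled vertices in which each of the $\binom{n}{2}$ possible edges is present independently with probability $p\in(0,1)$. A sequence of events $\mathcal{A}_n$ ($n=1,2,\dots$) occurs with high probability (w.h.p.) if $\lim_{n\to\infty}\Pr(\mathcal{A}_n)=1$. *)

(* Defs.v *)
From mathcomp Require Import all_boot all_order all_algebra.
From mathcomp Require Import classical_sets reals topology normedtype.

Set Implicit Arguments.
Unset Strict Implicit.
Unset Printing Implicit Defensive.

Import Order.TTheory GRing.Theory Num.Theory.
Import numFieldNormedType.Exports.

Local Open Scope ring_scope.

Section Graphs.
Variable V : finType.

(* A graph on the vertex set V is given by its set of edges; it is simple when
   every edge is a pair of distinct vertices. *)
Definition graph := {set {set V}}.

Definition pairs : graph := [set e : {set V} | #|e| == 2%N].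

Definition simple_graph (G : graph) : bool := G \subset pairs.

Definition adj (G : graph) : rel V := fun u v => [set u; v] \in G.

Definition connected_graph (G : graph) : bool :=
  [forall u, forall v, connect (adj G) u v].

Definition isolated (G : graph) (v : V) : bool := [forall w, ~~ adj G v w].

Definition component (G : graph) (C : {set V}) : bool :=
  [exists u, C == [set v | connect (adj G) u v]].

(* C itself may be a single isolated vertex, so that an edgeless graph on a
   nonempty vertex set qualifies. *)
Definition component_plus_isolated (G : graph) : bool :=
  [exists C : {set V}, component G C && [forall v in ~: C, isolated G v]].

(* The edges cover the vertex set. *)
Definition spanning (G : graph) : bool := [forall v, ~~ isolated G v].

Definition Bis (G : graph) (A : {set V}) : graph :=
  [set e in G | [exists u in A, exists v in ~: A, e == [set u; v]]].

End Graphs.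

Section ErdosRenyi.
Variable R : realType.

Definition gnp_weight (p : R) (n : nat) (G : graph 'I_n) : R :=
  \prod_(e in pairs 'I_n) (if e \in G then p else 1 - p).

Definition gnp_prob (p : R) (n : nat) (Q : pred (graph 'I_n)) : R :=
  \sum_(G : graph 'I_n | simple_graph G && Q G) gnp_weight p G.

Definition whp (p : R) (Q : forall n : nat, pred (graph 'I_n)) : Prop :=
  ((fun n : nat => gnp_prob p (Q n)) @ \oo --> (1 : R))%classic.

End ErdosRenyi.

(* Main.v *)
(** For fixed [0 < p] the following holds w.h.p.: any four vertices have a
    common neighbor.  A common neighbor of the endpoints of two edges of
    [Bis(A)] joins these edges inside [Bis(A)], so all edges of [Bis(A)] lie in
    one component; this already gives (2).  For (3) it remains to exclude
    isolated vertices: a vertex isolated in [Bis(A)] is non-adjacent to the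
    whole opposite side, which has at least [(1/2 - eps (1/2 - eps)) n]
    vertices, whereas by Chernoff's bound no vertex has that many
    non-neighbors.  For (1), Chernoff's bound gives a vertex of degree less than
    [n/2 - 1], which becomes isolated in [Bis(A)] as soon as [A] contains it
    together with its neighborhood. *)

Require Import Defs.
From mathcomp Require Import all_boot all_order all_algebra.
From mathcomp Require Import classical_sets reals topology normedtype.
From mathcomp Require Import sequences exp ring lra zify fintype finset.
Import Order.TTheory GRing.Theory Num.Theory.
Import numFieldNormedType.Exports.
Local Open Scope ring_scope.

Set Implicit Arguments.
Unset Strict Implicit.
Unset Printing Implicit Defensive.

(** * Deterministic facts about [Bis] *)

Lemma adjC (V : finType) (G : graph V) (u v : V) : adj G u v = adj G v u.
Proof. by rewrite /adj setUC. Qed.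

Lemma adj_irr (V : finType) (G : graph V) (u v : V) :
  simple_graph G -> adj G u v -> u != v.
Proof.
by move=> /subsetP sG /sG; rewrite inE cards2; case: (u != v).
Qed.

Lemma adj_Bis (V : finType) (G : graph V) (A : {set V}) (u v : V) :
  adj (Bis G A) u v = adj G u v && ((u \in A) (+) (v \in A)).
Proof.
rewrite /adj inE; congr (_ && _).
apply/exists_inP/idP => [[x xA /exists_inP[y]]|].
  rewrite inE => yA /eqP E.
  have: (u \in [set x; y]) && (v \in [set x; y]) by rewrite -E !inE !eqxx orbT.
  have: (x \in [set u; v]) && (y \in [set u; v]) by rewrite E !inE !eqxx orbT.
  rewrite !inE => /andP[/orP[]/eqP xE /orP[]/eqP yE] _; move: xA yA;
    by rewrite ?xE ?yE => uA; rewrite ?uA //= => /negPf ->.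
case: (boolP (u \in A)) => uA /= vA.
- by exists u => //; apply/exists_inP; exists v; rewrite // inE.
- exists v => //; apply/exists_inP; exists u; first by rewrite inE.
  by rewrite setUC.
Qed.

Lemma connect_adjC (V : finType) (G : graph V) (u v : V) :
  connect (adj G) u v = connect (adj G) v u.
Proof. by apply: sym_connect_sym => x y; rewrite adjC. Qed.

(** Tuples may repeat entries, so two edges that share an endpoint are covered as well. *)
Definition common_neighbors (V : finType) (k : nat) (G : graph V) : bool :=
  [forall t : k.-tuple V, [exists w, all (adj G w) t]].

(* A common neighbor [w] of all four endpoints is opposite to one endpoint of
   each edge, whichever side of the bipartition it is on. *)
Lemma connect_Bis_edges (V : finType) (G : graph V) (A : {set V})
    (a b c d : V) :
  common_neighbors 4 G -> adj (Bis G A) a b -> adj (Bis G A) c d ->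
  connect (adj (Bis G A)) a c.
Proof.
move=> /forallP /(_ [tuple a; b; c; d]) /existsP[w] /= /and5P[wa wb wc wd _].
have via x y : adj (Bis G A) x y -> adj G w x -> adj G w y ->
    connect (adj (Bis G A)) w x.
  move=> xy wx wy; move: (xy); rewrite adj_Bis => /andP[_ xyA].
  have [wxA|wxA] := boolP ((w \in A) (+) (x \in A)).
    by apply: connect1; rewrite adj_Bis wx.
  apply: (@connect_trans _ _ y); last by rewrite connect_adjC connect1.
  apply: connect1; rewrite adj_Bis wy; move: xyA wxA.
  by case: (w \in A); case: (x \in A); case: (y \in A).
move=> ab cd; apply: (@connect_trans _ _ w); last exact: (via c d).
by rewrite connect_adjC; apply: (via a b).
Qed.

Lemma common_neighbors_Bis (V : finType) (G : graph V) (A : {set V}) :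
  (0 < #|V|)%N -> common_neighbors 4 G -> component_plus_isolated (Bis G A).
Proof.
move=> /card_gt0P[x0 _] cnG.
have [/existsP[a /existsP[b ab]]|noedge] :=
    boolP [exists a, exists b, adj (Bis G A) a b].
  apply/existsP; exists [set v | connect (adj (Bis G A)) a v].
  apply/andP; split; first by apply/existsP; exists a.
  apply/forall_inP => v; rewrite !inE; apply: contraR.
  rewrite negb_forall => /existsP[w]; rewrite negbK => vw.
  exact: (connect_Bis_edges cnG ab vw).
(* Without edges every vertex is isolated, so the component of any vertex serves. *)
apply/existsP; exists [set v | connect (adj (Bis G A)) x0 v].
apply/andP; split; first by apply/existsP; exists x0.
apply/forall_inP => v _; apply/forallP => w; move: noedge.
by rewrite negb_exists => /forallP/(_ v); rewrite negb_exists => /forallP/(_ w).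
Qed.

Lemma common_neighbors_connected (V : finType) (G : graph V) (A : {set V}) :
  common_neighbors 4 G -> spanning (Bis G A) -> connected_graph (Bis G A).
Proof.
move=> cnG /forallP spG; apply/forallP => u; apply/forallP => v.
have edge x : exists y, adj (Bis G A) x y.
  have := spG x; rewrite negb_forall => /existsP[y]; rewrite negbK; by exists y.
have [[u' uu'] [v' vv']] := (edge u, edge v).
exact: (connect_Bis_edges cnG uu' vv').
Qed.

(* [true] selects the neighbors of [v], [false] the non-neighbors other than
   [v] itself. *)
Definition star (V : finType) (G : graph V) (b : bool) (v : V) : {set V} :=
  [set w | (w != v) && (adj G v w == b)].

(** If [v] were isolated, the side opposite to it would consist of non-neighbors of [v]. Either side
    can be the opposite one, hence the two bounds. *)
Lemma Bis_not_isolated (V : finType) (G : graph V) (A : {set V}) (v : V) :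
  (#|star G false v| < #|A|)%N -> (#|star G false v| < #|~: A|)%N ->
  ~~ Defs.isolated (Bis G A) v.
Proof.
move=> ltA ltAc; apply/negP => /forallP iso.
have sub : [set w | (v \in A) (+) (w \in A)] \subset star G false v.
  apply/subsetP => w; rewrite !inE => vw; apply/andP; split.
    by apply: contraTneq vw => ->; case: (v \in A).
  by have := iso w; rewrite adj_Bis vw andbT eqbF_neg.
have := subset_leq_card sub; apply/negP; rewrite -ltnNge.
have [vA|vA] := boolP (v \in A).
  apply: leq_trans ltAc _; apply/subset_leq_card/subsetP => w.
  by rewrite !inE.
by apply: leq_trans ltA _; apply/subset_leq_card/subsetP => w; rewrite !inE.
Qed.

Lemma exists_superset_card (V : finType) (B : {set V}) (k : nat) :
  (#|B| <= k <= #|V|)%N -> exists2 A : {set V}, B \subset A & #|A| = k.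
Proof.
move=> /andP[Bk kV].
(* A positive binomial coefficient yields a set of the missing size in the complement of [B]. *)
have : (0 < 'C(#|~: B|, k - #|B|))%N.
  by rewrite bin_gt0 (cardsCs (~: B)) setCK leq_sub2r.
rewrite -cards_draws => /card_gt0P[C]; rewrite inE => /andP[CB /eqP Ck].
exists (B :|: C); first exact: subsetUl.
rewrite cardsU Ck (_ : B :&: C = set0) ?cards0 ?subn0 ?subnKC //.
by apply/eqP; rewrite setI_eq0 disjoint_sym disjoints_subset.
Qed.

Lemma exists_Bis_disconnected (V : finType) (G : graph V) (v : V) (k : nat) :
  simple_graph G -> (#|star G true v| < k)%N -> (k < #|V|)%N ->
  exists A : {set V}, (#|A| == k) && ~~ connected_graph (Bis G A).
Proof.
move=> sG degv kV.
(* The strict degree bound leaves room for [v] itself next to its neighbors. *)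
have [|A /subsetP sA /eqP cA] := @exists_superset_card V (v |: star G true v) k.
  by rewrite cardsU1 inE eqxx /= add1n degv ltnW.
exists A; rewrite cA /=; apply/negP => /forallP/(_ v)/forallP conn.
have [u uA] : exists u, u \notin A.
  have : (0 < #|~: A|)%N by rewrite (cardsCs (~: A)) setCK (eqP cA) subn_gt0.
  by move=> /card_gt0P[u]; rewrite inE; exists u.
have vA : v \in A by apply: sA; rewrite !inE eqxx.
(* A path from [v] to [u] would start with an edge of [Bis G A] from [v] to some [w] outside [A],
   but [A] contains all neighbors of [v]. *)
have /connectP[[|w q] /=] := conn u; first by move=> _ uv; rewrite uv vA in uA.
rewrite adj_Bis vA /= => /andP[/andP[vw]] /negP + _ _; apply.
by apply: sA; rewrite !inE vw eqxx andbT eq_sym (adj_irr sG vw) orbT.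
Qed.

(** * Expectation over the random graph, independence of edges, union bound *)

Section Expectation.
Variables (R : realType) (p : R).

Definition gnp_expect (n : nat) (f : graph 'I_n -> R) : R :=
  \sum_(G : graph 'I_n | simple_graph G) gnp_weight p G * f G.

Lemma gnp_probE (n : nat) (Q : pred (graph 'I_n)) :
  gnp_prob p Q = gnp_expect (fun G => (Q G)%:R).
Proof.
rewrite /gnp_prob big_mkcondr; apply: eq_bigr => G _.
by case: (Q G); rewrite ?mulr1 ?mulr0.
Qed.

(** Independence of the edges: expanding the product of the binomials [f e + g e] gives one term per
    edge set, and [f] vanishes off [pairs], so only simple graphs contribute. *)
Lemma gnp_expect_prod (n : nat) (h : {set 'I_n} -> bool -> R) :
  gnp_expect (fun G => \prod_(e in pairs 'I_n) h e (e \in G)) =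
  \prod_(e in pairs 'I_n) (p * h e true + (1 - p) * h e false).
Proof.
pose f e := if e \in pairs 'I_n then p * h e true else 0.
pose g e := if e \in pairs 'I_n then (1 - p) * h e false else 1.
transitivity (\prod_e (f e + g e)); last first.
  rewrite [RHS]big_mkcond; apply: eq_bigr => e _.
  by rewrite /f /g; case: ifP => // _; rewrite add0r.
rewrite bigA_distr /gnp_expect big_mkcond; apply: eq_bigr => G _.
case: ifPn => [sG|].
  rewrite /gnp_weight -big_split big_mkcond; apply: eq_bigr => e _ /=.
  rewrite /f /g; case: ifP; case: ifP => // eG eP.
  by move/subsetP: sG => /(_ _ eG); rewrite eP.
move=> /subsetPn[e eG eP]; rewrite (bigD1 e) //= eG /f (negPf eP).
by rewrite mul0r.
Qed.

(** Each edge outside the image of [e] contributes the factor [p + (1 - p) = 1]. *)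
Lemma gnp_expect_imset (n : nat) (I : finType) (A : {set I})
    (e : I -> {set 'I_n}) (h : bool -> R) :
  {in A &, injective e} -> {in A, forall i, #|e i| = 2%N} ->
  gnp_expect (fun G => \prod_(i in A) h (e i \in G)) =
  (p * h true + (1 - p) * h false) ^+ #|A|.
Proof.
move=> inje e2.
have sub : e @: A \subset pairs 'I_n.
  by apply/subsetP => _ /imsetP[i iA ->]; rewrite inE e2.
have imE (f : {set 'I_n} -> R) : \prod_(i in A) f (e i) =
    \prod_(x in pairs 'I_n) (if x \in e @: A then f x else 1).
  rewrite -(big_imset f inje) /= -big_mkcondr; apply: eq_bigl => x.
  by case: (boolP (x \in e @: A)) => [/(subsetP sub) ->|]; rewrite ?andbF.
transitivity (gnp_expect (fun G => \prod_(x in pairs 'I_n)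
    (if x \in e @: A then h (x \in G) else 1))).
  by apply: eq_bigr => G _; rewrite (imE (fun x => h (x \in G))).
rewrite (gnp_expect_prod (fun x b => if x \in e @: A then h b else 1)).
rewrite -prodr_const (imE (fun=> p * h true + (1 - p) * h false)).
by apply: eq_bigr => x _; case: ifP => // _; rewrite !mulr1 subrKC.
Qed.

Lemma gnp_expect1 (n : nat) : @gnp_expect n (fun=> 1) = 1.
Proof.
have := gnp_expect_prod (fun (_ : {set 'I_n}) _ => 1).
rewrite [RHS]big1; last by move=> e _; rewrite !mulr1 subrKC.
by move=> E; rewrite -[RHS]E; apply: eq_bigr => G _; rewrite big1.
Qed.

Lemma gnp_expect_sum (n : nat) (I : finType) (P : pred I)
    (f : I -> graph 'I_n -> R) :
  gnp_expect (fun G => \sum_(i | P i) f i G) = \sum_(i | P i) gnp_expect (f i).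
Proof.
by rewrite exchange_big; apply: eq_bigr => G _; rewrite mulr_sumr.
Qed.

Lemma gnp_expectZ (n : nat) (a : R) (f : graph 'I_n -> R) :
  gnp_expect (fun G => a * f G) = a * gnp_expect f.
Proof. by rewrite mulr_sumr; apply: eq_bigr => G _; rewrite mulrCA. Qed.

Lemma gnp_probC (n : nat) (Q : pred (graph 'I_n)) :
  gnp_prob p Q = 1 - gnp_prob p (predC Q).
Proof.
rewrite -(gnp_expect1 n) !gnp_probE -sumrB; apply: eq_bigr => G _ /=.
by rewrite -mulrBr; case: (Q G); rewrite ?subr0 ?subrr.
Qed.

Hypotheses (p0 : 0 <= p) (p1 : p <= 1).

Lemma gnp_weight_ge0 (n : nat) (G : graph 'I_n) : 0 <= gnp_weight p G.
Proof. by apply: prodr_ge0 => e _; case: ifP; rewrite ?subr_ge0. Qed.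

Lemma gnp_expect_le (n : nat) (f g : graph 'I_n -> R) :
  (forall G, simple_graph G -> f G <= g G) -> gnp_expect f <= gnp_expect g.
Proof.
by move=> fg; apply: ler_sum => G sG; rewrite ler_wpM2l ?gnp_weight_ge0 ?fg.
Qed.

Lemma gnp_prob_ge0 (n : nat) (Q : pred (graph 'I_n)) : 0 <= gnp_prob p Q.
Proof. by apply: sumr_ge0 => G _; apply: gnp_weight_ge0. Qed.

Lemma gnp_prob_union (n : nat) (I : finType) (Q : pred (graph 'I_n))
    (B : I -> pred (graph 'I_n)) :
  (forall G, simple_graph G -> Q G -> exists i, B i G) ->
  gnp_prob p Q <= \sum_i gnp_prob p (B i).
Proof.
move=> QB; under eq_bigr do rewrite gnp_probE.
rewrite -gnp_expect_sum gnp_probE; apply: gnp_expect_le => G sG.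
have ge0 (P : pred I) : 0 <= \sum_(i | P i) (B i G)%:R :> R.
  by apply: sumr_ge0 => i _; rewrite ler0n.
case: (boolP (Q G)) => [/(QB _ sG)[i iG]|_]; last exact: ge0.
by rewrite (bigD1 i) //= iG lerDl ge0.
Qed.

End Expectation.

(** * Probability bounds for a fixed vertex set or a fixed vertex *)

Lemma prod_1D (R : comNzRingType) (I : finType) (A : {set I}) (g : I -> R) :
  \prod_(i in A) (1 + g i) = \sum_(W : {set I} | W \subset A) \prod_(i in W) g i.
Proof.
pose f i := if i \in A then g i else 0.
transitivity (\prod_i (f i + 1)).
  rewrite [LHS]big_mkcond; apply: eq_bigr => i _.
  by rewrite /f; case: ifP => // _; rewrite ?add0r // addrC.
rewrite bigA_distr [RHS]big_mkcond; apply: eq_bigr => W _.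
case: ifPn => [/subsetP WA|/subsetPn[i iW iA]].
  rewrite [RHS]big_mkcond; apply: eq_bigr => i _.
  by rewrite /f; case: ifP => // /WA ->.
by rewrite (bigD1 i) //= iW /f (negPf iA) mul0r.
Qed.

Section Bounds.
Variables (R : realType) (p : R).
Hypotheses (p0 : 0 <= p) (p1 : p <= 1).

(* The blocks of edges between [w] and [S] are independent for distinct [w]:
   expanding the product over [w] turns every term into a product over distinct
   edges, and the terms add up to the same product of expectations. *)
Lemma no_common_neighbor_prob (n : nat) (S : {set 'I_n}) :
  gnp_prob p (fun G => ~~ [exists w, [forall s in S, adj G w s]])
    <= (1 - p ^+ #|S|) ^+ #|~: S|.
Proof.
pose X (G : graph 'I_n) w : R := \prod_(s in S) ([set w; s] \in G)%:R.
have X1 G w : X G w <= 1.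
  by apply: Num.Theory.prodr_ile1 => s _; case: (_ \in G); rewrite ?lexx ?ler01.
(* [X G w] indicates that [w] is adjacent to all of [S]; the product is 1 on the bad event and
   nonnegative otherwise. Only [w] outside [S] enter, so that distinct blocks share no edge. *)
apply: (@le_trans _ _ (gnp_expect p (fun G => \prod_(w in ~: S) (1 - X G w)))).
  rewrite gnp_probE; apply: gnp_expect_le => // G _.
  have [bad|_] := boolP (~~ _); last first.
    by apply: prodr_ge0 => w _; rewrite subr_ge0 X1.
  rewrite big1 // => w _; move: bad; rewrite negb_exists => /forallP/(_ w).
  rewrite negb_forall_in => /exists_inP[s sS].
  by rewrite /adj => /negPf ws; rewrite /X (bigD1 s) //= ws mul0r subr0.
under [X in X <= _]eq_bigr do rewrite prod_1D.
rewrite -/(gnp_expect p _) gnp_expect_sum -prodr_const prod_1D le_eqVlt.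
apply/orP; left; apply/eqP; apply: eq_bigr => W /subsetP WS.
rewrite prodr_const exprNn -exprM.
pose e (i : 'I_n * 'I_n) := [set i.1; i.2].
pose h (b : bool) : R := b%:R.
(* [W] avoids [S], so an edge between them determines which endpoint lies in which set. *)
have inje : {in setX W S &, injective e}.
  move=> [w s] [w' s']; rewrite !in_setX /= => /andP[wW sS] /andP[wW' sS'] E.
  have nS x : x \in W -> x \notin S by move=> /WS; rewrite inE.
  have /setP/(_ w') := E; have /setP/(_ s') := E.
  rewrite !inE !eqxx !orbT /= => /orP[]/eqP s'E /orP[]/eqP w'E; subst => //.
  - by rewrite (negPf (nS _ wW)) in sS'.
  - by rewrite (negPf (nS _ wW)) in sS'.
  - by rewrite (negPf (nS _ wW')) in sS.
have e2 : {in setX W S, forall i, #|e i| = 2%N}.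
  move=> [w s]; rewrite in_setX /= => /andP[wW sS].
  have wS : w \notin S by have := WS _ wW; rewrite inE.
  by rewrite cards2 /=; case: eqP => // ws; rewrite ws sS in wS.
have := gnp_expect_imset p h inje e2.
rewrite cardsX /h mulr1 mulr0 addr0 mulnC => <-.
rewrite -gnp_expectZ; apply: eq_bigr => G _; congr (_ * _).
rewrite prodrN; congr (_ * _); rewrite pair_big /=.
by apply: eq_bigl => -[w s]; rewrite in_setX.
Qed.

(** Chernoff's method: Markov's inequality for [expR (t * #|star G b v|%:R)], whose expectation
    factors over the edges at [v]. *)
Lemma star_tail (n : nat) (b : bool) (v : 'I_n) (t a : R) :
  0 <= t ->
  gnp_prob p (fun G => a <= #|star G b v|%:R) <=
  expR (n%:R * ((if b then p else 1 - p) * (expR t - 1)) - t * a).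
Proof.
move=> t0; set q := if b then p else 1 - p.
have q0 : 0 <= q by rewrite /q; case: (b); rewrite ?subr_ge0.
have et1 : 1 <= expR t by apply: le_trans (expR_ge1Dx t); rewrite lerDl.
pose h c := if c == b then expR t else 1.
apply: (@le_trans _ _ (gnp_expect p (fun G => expR (- (t * a)) *
    \prod_(w in [set~ v]) h ([set v; w] \in G)))).
  rewrite gnp_probE; apply: gnp_expect_le => // G _.
  have -> : \prod_(w in [set~ v]) h ([set v; w] \in G) =
      expR (t * #|star G b v|%:R).
    rewrite /h -big_mkcondr /= expRM_natr -prodr_const.
    by apply: eq_bigl => w; rewrite !inE.
  rewrite -expRD; case: (boolP (a <= _)) => [ha|_]; last exact: expR_ge0.
  rewrite -[X in X <= _]expR0 ler_expR addrC -mulrBr mulr_ge0 ?subr_ge0 //.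
rewrite gnp_expectZ gnp_expect_imset.
- rewrite [X in _ <= X]expRD mulrC ler_wpM2r ?expR_ge0 // expRM_natl.
  have -> : p * h true + (1 - p) * h false = 1 + q * (expR t - 1).
    by rewrite /h /q; case: (b) => /=; ring.
  have qt0 : 0 <= q * (expR t - 1) by rewrite mulr_ge0 ?subr_ge0.
  (* The base is at least 1 because [t >= 0], so the number of other vertices may be raised to
     [n]. *)
  apply: (@le_trans _ _ ((1 + q * (expR t - 1)) ^+ n)).
    rewrite ler_weXn2l ?lerDl // -[X in (_ <= X)%N]card_ord.
    exact: max_card.
  by rewrite lerXn2r ?expR_ge1Dx // nnegrE ?expR_ge0 ?addr_ge0.
- move=> w w'; rewrite !inE => /negPf wv _ /setP/(_ w).
  by rewrite !inE wv eqxx => /esym/eqP.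
- by move=> w; rewrite !inE cards2 eq_sym => ->.
Qed.

End Bounds.

(** * Passage to the limit *)

Section Whp.
Variables (R : realType) (p : R).
Hypotheses (p0 : 0 <= p) (p1 : p <= 1).

Lemma gnp_prob_le1 (n : nat) (Q : pred (graph 'I_n)) : gnp_prob p Q <= 1.
Proof. by rewrite gnp_probC gerBl gnp_prob_ge0. Qed.

(** The term of degree [k.+1] in the exponential series beats [n ^ k] by one power of [n], so the
    failure probability is O(1/n). *)
Lemma whp_exp_bound (Q : forall n, pred (graph 'I_n)) (K c : R) (k : nat) :
  0 <= K -> 0 < c ->
  (forall n, gnp_prob p (predC (Q n)) <=
             K * n%:R ^+ k * expR (- (n%:R * c))) ->
  whp p Q.
Proof.
move=> K0 c0 failQ; rewrite /whp.
(* [harmonic n] is [1 / (n + 1)]; the factor 2 accounts for [1 / n <= 2 / (n + 1)]. *)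
pose M := 2 * K * (k.+1)`!%:R / c ^+ k.+1.
have bound n : (0 < n)%N -> gnp_prob p (predC (Q n)) <= M * harmonic n.
  move=> n0; apply: (le_trans (failQ n)).
  have nR0 : 0 < n%:R :> R by rewrite ltr0n.
  have x0 : 0 < (n%:R * c) ^+ k.+1 / (k.+1)`!%:R.
    by rewrite divr_gt0 ?exprn_gt0 ?mulr_gt0 // ltr0n fact_gt0.
  have : expR (- (n%:R * c)) <= ((n%:R * c) ^+ k.+1 / (k.+1)`!%:R)^-1.
    rewrite expRN lef_pV2 ?posrE ?expR_gt0 //.
    apply: le_trans (expR_ge1Dxn k _); first by rewrite lerDr.
    by rewrite mulr_ge0 // ltW.
  have Kn0 : 0 <= K * n%:R ^+ k by rewrite mulr_ge0 // exprn_ge0 // ltW.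
  move=> /(ler_wpM2l Kn0) /le_trans; apply.
  have -> : K * n%:R ^+ k * ((n%:R * c) ^+ k.+1 / (k.+1)`!%:R)^-1 =
      K * (k.+1)`!%:R / c ^+ k.+1 / n%:R.
    have f0 : (k.+1)`!%:R != 0 :> R by rewrite pnatr_eq0 -lt0n fact_gt0.
    have n0' : n%:R != 0 :> R by rewrite gt_eqF.
    have ck0 : c ^+ k.+1 != 0 by rewrite expf_neq0 // gt_eqF.
    have nk0 : n%:R ^+ k != 0 :> R by rewrite expf_neq0.
    rewrite exprMn (exprS n%:R); field.
    by rewrite n0' ck0 f0 nk0.
  have -> : M * harmonic n = K * (k.+1)`!%:R / c ^+ k.+1 * (2 / n.+1%:R).
    by rewrite /M /harmonic /=; ring.
  apply: ler_wpM2l; first by rewrite divr_ge0 ?mulr_ge0 ?exprn_ge0 ?ler0n // ltW.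
  rewrite ler_pdivlMr ?ltr0n // mulrC ler_pdivrMr // -natrM ler_nat.
  by rewrite mul2n -addnn -addn1 leq_add2l.
have cvg0 : ((fun n => 1 - M * harmonic n) @ \oo --> (1 : R))%classic.
  rewrite -[X in (_ --> X)%classic]subr0 -(mulr0 M).
  by apply: cvgB; [exact: cvg_cst | apply: cvgM; [exact: cvg_cst | exact: cvg_harmonic]].
apply: (squeeze_cvgr _ cvg0 (cvg_cst (1 : R))).
near=> n; rewrite gnp_prob_le1 andbT gnp_probC lerB // bound //.
by near: n; exists 1%N.
Unshelve. all: by end_near.
Qed.

(** Union bound over the two failures, indexed by [bool]. With [P1 = P2] this is monotonicity of
    [whp], restricted to simple graphs and positive [n]. *)
Lemma whp_and (P1 P2 Q : forall n, pred (graph 'I_n)) :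
  (forall n (G : graph 'I_n), (0 < n)%N -> simple_graph G ->
     P1 n G -> P2 n G -> Q n G) ->
  whp p P1 -> whp p P2 -> whp p Q.
Proof.
move=> PQ wP1 wP2; rewrite /whp.
have cvg1 : ((fun n => gnp_prob p (P1 n) + gnp_prob p (P2 n) - 1) @ \oo
    --> (1 : R))%classic.
  rewrite -[X in (_ --> X)%classic](addrK 1).
  by apply: cvgB; [exact: cvgD | exact: cvg_cst].
apply: (squeeze_cvgr _ cvg1 (cvg_cst (1 : R))).
near=> n; rewrite gnp_prob_le1 andbT (gnp_probC p (Q n)) // (gnp_probC p (P1 n)).
rewrite (gnp_probC p (P2 n)).
suff : gnp_prob p (predC (Q n)) <=
    \sum_b gnp_prob p (predC (if b then P1 n else P2 n)).
  by rewrite big_bool /=; lra.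
apply: gnp_prob_union => // G sG /= nQ.
have [G1|] := boolP (P1 n G); last by exists true.
have [G2|] := boolP (P2 n G); last by exists false.
case/negP: nQ; apply: PQ => //.
by near: n; exists 1%N.
Unshelve. all: by end_near.
Qed.

(** The slack of 1 makes room for the vertex itself in part (1); it costs only the constant factor
    [expR t]. *)
Lemma whp_star_lt (b : bool) (d : R) :
  (if b then p else 1 - p) < d ->
  whp p (fun n G => [forall v, #|star G b v|%:R < n%:R * d - 1]).
Proof.
set q := if b then p else 1 - p => qd.
have q0 : 0 <= q by rewrite /q; case: (b); rewrite ?subr_ge0.
have d0 : 0 < d by apply: le_lt_trans qd.
(* As [expR t - 1 <= t / (1 - t)], the rate [c] below is positive once [q / d < 1 - t]; this [t] is
   half of the admissible range. *)
pose t := (1 - q / d) / 2.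
have qd1 : q / d < 1 by rewrite ltr_pdivrMr ?mul1r.
have qd0 : 0 <= q / d by rewrite divr_ge0 // ltW.
have t0 : 0 < t by rewrite /t; lra.
have t1 : 0 < 1 - t by rewrite /t; lra.
have exp_le : expR t - 1 <= t / (1 - t).
  have : expR t <= (1 - t)^-1.
    rewrite -[X in expR X]opprK expRN lef_pV2 ?posrE ?expR_gt0 //.
    exact: expR_ge1Dx.
  suff -> : t / (1 - t) = (1 - t)^-1 - 1 by rewrite lerD2r.
  by field; rewrite gt_eqF.
pose c := t * d - q * (expR t - 1).
have c0 : 0 < c.
  rewrite /c subr_gt0; apply: le_lt_trans (ler_wpM2l q0 exp_le) _.
  rewrite mulrCA ltr_pM2l // ltr_pdivrMr // mulrC -ltr_pdivrMr //.
  by rewrite /t; lra.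
apply: (@whp_exp_bound _ (expR t) c 1) => //; first exact: expR_ge0.
move=> n; pose B v (G : graph 'I_n) := n%:R * d - 1 <= #|star G b v|%:R.
apply: (@le_trans _ _ (\sum_v gnp_prob p (B v))).
  apply: gnp_prob_union => // G _; rewrite /= negb_forall => /existsP[v].
  by rewrite -leNgt; exists v.
have tail v : gnp_prob p (B v) <= expR t * expR (- (n%:R * c)).
  apply: le_trans (star_tail p0 p1 b v _ (ltW t0)) _.
  by rewrite -expRD ler_expR -/q /c; lra.
apply: le_trans (ler_sum _ (fun v _ => tail v)) _.
by rewrite sumr_const card_ord expr1 mulrAC mulr_natr.
Qed.

Lemma whp_common_neighbors (k : nat) :
  0 < p -> whp p (fun n (G : graph 'I_n) => common_neighbors k G).
Proof.
move=> p_gt0; pose c := p ^+ k.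
have c0 : 0 < c by rewrite exprn_gt0.
apply: (@whp_exp_bound _ (expR (k%:R * c)) c k) => //; first exact: expR_ge0.
move=> n; pose B (t : k.-tuple 'I_n) (G : graph 'I_n) :=
  ~~ [exists w, [forall s in [set x in t], adj G w s]].
apply: (@le_trans _ _ (\sum_t gnp_prob p (B t))).
  apply: gnp_prob_union => // G _; rewrite /= negb_forall => /existsP[t].
  rewrite negb_exists => /forallP noc; exists t; rewrite /B negb_exists.
  apply/forallP => w; apply: contra (noc w) => /forall_inP adjw.
  by apply/allP => s st; apply: adjw; rewrite inE.
(* The factor [expR (k%:R * c)] pays for the at most [k] vertices of [S]. Repeated entries only
   shrink [S], which increases [p ^+ #|S|]. *)
have tail t : gnp_prob p (B t) <= expR (k%:R * c) * expR (- (n%:R * c)).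
  apply: le_trans (no_common_neighbor_prob p0 p1 _) _.
  set S := [set x in t].
  have Sk : (#|S| <= k)%N.
    by rewrite cardsE -[X in (_ <= X)%N](size_tuple t) card_size.
  have pS0 : 0 <= 1 - p ^+ #|S| by rewrite subr_ge0 exprn_ile1.
  have : (1 - p ^+ #|S|) ^+ #|~: S| <= expR (- c) ^+ #|~: S|.
    rewrite lerXn2r ?nnegrE ?expR_ge0 //; apply: le_trans (expR_ge1Dx _).
    by rewrite lerD2l lerN2 ler_wiXn2l.
  move=> /le_trans; apply; rewrite -expRM_natl -expRD ler_expR.
  have : n%:R <= #|~: S|%:R + k%:R :> R.
    rewrite -natrD ler_nat -[X in (X <= _)%N](card_ord n) -(cardsC S) addnC.
    by rewrite leq_add2l.
  by move=> /(ler_wpM2r (ltW c0)); lra.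
apply: le_trans (ler_sum _ (fun t _ => tail t)) _.
by rewrite sumr_const card_tuple card_ord -natrX mulrAC mulr_natr.
Qed.

End Whp.

Unset Implicit Arguments.

Theorem theorem2p5 (R : realType) :
  (forall p : R, 0 < p -> p < 1 / 2 ->
     whp p (fun n (G : graph 'I_n) =>
       [exists A : {set 'I_n}, (#|A| == n./2) && ~~ connected_graph (Bis G A)]))
  /\
  (forall p : R, 1 / 2 < p -> p < 1 ->
     whp p (fun n (G : graph 'I_n) =>
       [forall A : {set 'I_n}, component_plus_isolated (Bis G A)]))
  /\
  (forall p eps : R, 0 < eps -> p = 1 / 2 + eps -> p < 1 ->
     whp p (fun n (G : graph 'I_n) =>
       [forall A : {set 'I_n},
          (`| #|A|%:R - n%:R / 2 | < eps * (1 / 2 - eps) * n%:R) ==>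
          connected_graph (Bis G A) && spanning (Bis G A)])).
Proof.
split; [|split].
- move=> p p0 p2.
  have p1 : p <= 1 by lra.
  have wdeg := @whp_star_lt R p (ltW p0) p1 true (1 / 2) p2.
  apply: (whp_and (ltW p0) p1 _ wdeg wdeg) => -[//|n] G _ sG /forallP deg _.
  (* All degrees are small, so any vertex would do. *)
  apply/existsP/(@exists_Bis_disconnected _ _ ord0) => //.
    have := deg ord0; rewrite ltrBrDr => deg0.
    have : (#|star G true ord0| + 1)%N%:R * 2%:R < n.+1%:R :> R.
      by rewrite natrD; lra.
    rewrite -natrM ltr_nat -divn2.
    by move: #|star G true ord0| => x; lia.
  by rewrite card_ord -divn2; lia.
- move=> p p2 p1.
  have p0 : 0 < p by lra.
  have wcn := whp_common_neighbors (ltW p0) (ltW p1) 4 p0.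
  apply: (whp_and (ltW p0) (ltW p1) _ wcn wcn) => n G n0 _ cnG _.
  by apply/forallP => A; apply: common_neighbors_Bis; rewrite ?card_ord.
- move=> p eps e0 pE p1.
  have p0 : 0 < p by lra.
  have wcn := whp_common_neighbors (ltW p0) (ltW p1) 4 p0.
  (* Here [1 - p = 1 / 2 - eps], and [eps * (1 / 2 - eps) < eps]. The right-hand side times [n]
     bounds the sizes of both [A] and its complement from below. *)
  have qd : 1 - p < 1 / 2 - eps * (1 / 2 - eps) by nra.
  have wdeg := @whp_star_lt R p (ltW p0) (ltW p1) false _ qd.
  apply: (whp_and (ltW p0) (ltW p1) _ wcn wdeg) => n G _ _ cnG /forallP deg.
  apply/forallP => A; apply/implyP; rewrite ltr_norml => /andP[lA uA].
  have spA : spanning (Bis G A).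
    apply/forallP => v; have degv := deg v.
    have cA : #|A|%:R + #|~: A|%:R = n%:R :> R.
      by rewrite -natrD cardsC card_ord.
    by apply: Bis_not_isolated; rewrite -(ltr_nat R); lra.
  by rewrite spA andbT; apply: common_neighbors_connected.
Qed.
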